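(* Let $f:\mathbb{R}^{n}\to\mathbb{R}$ be continuously differentiable (without loss of generality, $f$ is taken to be non-negative on $[0,1]^{n}$). Let the activation function $\boldsymbol{\sigma}:\mathbb{R}^{n}\to(0,1)^{n}$ be a homeomorphism that is differentiable almost everywhere and has the structure $\boldsymbol{\sigma}(\boldsymbol{y})=(\sigma_{1}(y_{1}),\ldots,\sigma_{n}(y_{n}))^{\top}$, i.e. its $i$-th component depends only on the $i$-th component of the argument, where $\sigma_{i}(\cdot)$ is strictly increasing for all $i=1,\ldots,n$. Consider the deterministic Hopfield neural network dynamics $$\dot{\boldsymbol{x}}_{\mathrm{H}}=-\nabla f(\boldsymbol{x}),\qquad \boldsymbol{x}=\boldsymbol{\sigma}(\boldsymbol{x}_{\mathrm{H}}),\qquad \boldsymbol{x}(t=0)\in(0,1)^{n},$$ equivalently $$\dot{\boldsymbol{x}}=-\left(\nabla_{\boldsymbol{x}_{\mathrm{H}}}\boldsymbol{\sigma}\right)\big|_{\boldsymbol{x}_{\mathrm{H}}=\boldsymbol{\sigma}^{-1}(\boldsymbol{x})}\,\nabla f(\boldsymbol{x}).$$ Then the flow $\boldsymbol{x}(t)$ governed by these dynamics is a natural gradient descent for the function $f(\boldsymbol{x})$ on the manifold $\mathcal{M}=(0,1)^{n}$ with metric tensor $\boldsymbol{G}=[g_{ij}]_{i,j=1}^{n}$ given, for $i,j=1,\ldots,n$, by $$g_{ij}=\begin{cases}1/\sigma_{i}'\big(\sigma_{i}^{-1}(x_{i})\big) & \text{for } i=j,\\ 0 & \text{otherwise.}\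end{cases}$$
   Context: Here $\boldsymbol{x}$ and $\boldsymbol{x}_{\mathrm{H}}$ are the state and the hidden state, $\nabla f$ is the Euclidean gradient, $\nabla_{\boldsymbol{x}_{\mathrm{H}}}\boldsymbol{\sigma}$ is the Jacobian of $\boldsymbol{\sigma}$ (a diagonal matrix, by the component structure), and $'$ denotes derivative. Amari's natural gradient descent describes the steepest descent of $f$ on a Riemannian manifold $\mathcal{M}$ with metric tensor $\boldsymbol{G}\succ\boldsymbol{0}$ (symmetric positive definite). It is the recursion $$\boldsymbol{x}(k+1)=\boldsymbol{x}(k)-h\left(\boldsymbol{G}(\boldsymbol{x})\right)^{-1}\nabla f(\boldsymbol{x})\big|_{\boldsymbol{x}=\boldsymbol{x}(k)},$$ with iteration index $k\in\mathbb{N}$ and small step-size $h>0$; for $h\downarrow 0$ it gives the natural gradient dynamics $$\dot{\boldsymbol{x}}=-\left(\boldsymbol{G}(\boldsymbol{x})\right)^{-1}\nabla f(\boldsymbol{x}).$$ A flow is called a natural gradient descent for $f$ on $\mathcal{M}$ with metric tensor $\boldsymbol{G}$ if it is of this last form with $\boldsymbol{G}(\boldsymbol{x})\succ\boldsymbol{0}$ for all $\boldsymbol{x}\in\mathcal{M}$.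
   Formalization: The claim and the equivalence of the two dynamics are stated at the points of (0,1)^n where every σ_i'(σ_i^{-1}(x_i)) exists and is nonzero, and on all of (0,1)^n when this holds everywhere; elsewhere G is undefined (e.g. n=1, σ(y)=logistic(y³), x=1/2). *)

(* Defs.v *)
From HB Require Import structures.
From mathcomp Require Import all_boot all_order all_algebra.
From mathcomp Require Import all_classical all_reals all_analysis.

Set Implicit Arguments.
Unset Strict Implicit.
Unset Printing Implicit Defensive.

Import Order.TTheory GRing.Theory Num.Theory.
Import numFieldNormedType.Exports.

Local Open Scope classical_set_scope.
Local Open Scope ring_scope.

(* Points of R^n are column vectors, so that [A *m v] is the usual action of a
   matrix on a vector. *)

Definition gradient (R : realType) (n : nat) (f : 'cV[R]_n -> R)
    (p : 'cV[R]_n) : 'cV[R]_n :=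
  \col_i 'D_(delta_mx i 0) f p.

(* The library's ['J] acts on row vectors from the right, hence is the transpose
   of this matrix. *)
Definition jacobian_matrix (R : realType) (n : nat)
    (g : 'cV[R]_n -> 'cV[R]_n) (p : 'cV[R]_n) : 'M[R]_n :=
  \matrix_(i, j) 'D_(delta_mx j 0) (fun q : 'cV[R]_n => g q i 0) p.

Definition continuously_differentiable (R : realType) (n : nat)
    (f : 'cV[R]_n -> R) : Prop :=
  (forall p, differentiable f p) /\ continuous (gradient f).

Definition open_cube (R : realType) (n : nat) : set 'cV[R]_n :=
  [set p | forall i, 0 < p i 0 < 1].
Arguments open_cube : clear implicits.

Definition closed_cube (R : realType) (n : nat) : set 'cV[R]_n :=
  [set p | forall i, 0 <= p i 0 <= 1].
Arguments closed_cube : clear implicits.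

Definition spd_matrix (R : realType) (n : nat) (A : 'M[R]_n) : Prop :=
  A^T = A /\ forall v : 'cV[R]_n, v != 0 -> 0 < (v^T *m A *m v) 0 0.

(* n-dimensional Lebesgue null sets, through covers by countably many boxes of
   arbitrarily small total volume; the library has no Lebesgue measure on R^n. *)
Definition box (R : realType) (n : nat) (a b : 'cV[R]_n) : set 'cV[R]_n :=
  [set p | forall i, a i 0 <= p i 0 <= b i 0].

Definition lebesgue_null (R : realType) (n : nat) (N : set 'cV[R]_n) : Prop :=
  forall e : R, 0 < e ->
  exists a b : nat -> 'cV[R]_n,
    [/\ forall k i, a k i 0 <= b k i 0,
        N `<=` \bigcup_k box (a k) (b k) &
        (\sum_(0 <= k <oo) (\prod_i (b k i 0 - a k i 0))%:E <= e%:E)%E].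

Definition differentiable_ae (R : realType) (n : nat)
    (g : 'cV[R]_n -> 'cV[R]_n) : Prop :=
  lebesgue_null [set p | ~ differentiable g p].

Definition homeomorphism_onto (T U : ptopologicalType) (A : set U)
    (g : T -> U) : Prop :=
  [/\ set_bij setT A g, continuous g & {within A, continuous (pinv setT g)}].

Definition activation (R : realType) (n : nat) (sigma : 'cV[R]_n -> 'cV[R]_n)
    (s : 'I_n -> R -> R) : Prop :=
  [/\ homeomorphism_onto (open_cube R n) sigma,
      differentiable_ae sigma,
      forall y i, sigma y i 0 = s i (y i 0) &
      forall i, {homo s i : u v / u < v}].

(* Time interval [0, T[, with T = +oo allowed. *)
Definition times (R : realType) (T : \bar R) : set R :=
  [set t | 0 <= t /\ (t%:E < T)%E].

(* Derivative relative to the time set [I]: the ordinary one at interior points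
   of [I], the one-sided one at an endpoint. *)
Definition has_derivative_within (R : realType) (n : nat) (I : set R)
    (x : R -> 'cV[R]_n) (t : R) (v : 'cV[R]_n) : Prop :=
  (s - t)^-1 *: (x s - x t) @[s --> within I t^'] --> v.

Definition hopfield_flow (R : realType) (n : nat) (f : 'cV[R]_n -> R)
    (sigma : 'cV[R]_n -> 'cV[R]_n) (T : \bar R) (xH x : R -> 'cV[R]_n) : Prop :=
  [/\ open_cube R n (x 0),
      forall t, times T t -> x t = sigma (xH t) &
      forall t, times T t ->
        has_derivative_within (times T) xH t (- gradient f (x t))].

(* The equation is imposed at the times at which the flow is in [M]; on a
   manifold that the flow never leaves, this is every time. *)
Definition natural_gradient_descent (R : realType) (n : nat)
    (f : 'cV[R]_n -> R) (M : set 'cV[R]_n) (G : 'cV[R]_n -> 'M[R]_n)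
    (T : \bar R) (x : R -> 'cV[R]_n) : Prop :=
  (forall p, M p -> spd_matrix (G p)) /\
  (forall t, times T t -> M (x t) ->
     has_derivative_within (times T) x t
       (- (invmx (G (x t)) *m gradient f (x t)))).

Definition hopfield_metric (R : realType) (n : nat) (s : 'I_n -> R -> R)
    (p : 'cV[R]_n) : 'M[R]_n :=
  \matrix_(i, j)
    if i == j then 1 / derive1 (s i) (pinv setT (s i) (p i 0)) else 0.

(* The points of (0,1)^n at which the quotients 1 / s_i'(s_i^-1(p_i)) make
   sense. An activation that is only differentiable almost everywhere may have
   points at which some s_i' does not exist or vanishes; there the values of
   [hopfield_metric] are artefacts of total derivatives and of 1 / 0 = 0. *)
Definition metric_domain (R : realType) (n : nat) (s : 'I_n -> R -> R) :
    set 'cV[R]_n :=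
  [set p | open_cube R n p /\
     forall i, let y := pinv setT (s i) (p i 0) in
       derivable (s i) y 1 /\ derive1 (s i) y != 0].

(* Main.v *)
Require Import Defs.
From HB Require Import structures.
From mathcomp Require Import all_boot all_order all_algebra.
From mathcomp Require Import all_classical all_reals all_analysis.
Import Order.TTheory GRing.Theory Num.Theory.
Import numFieldNormedType.Exports.
Local Open Scope classical_set_scope.
Local Open Scope ring_scope.

(** Since sigma acts coordinate by coordinate, its Jacobian at y is the diagonal
    matrix of the s_i'(y_i) ([jacobian_matrix_componentwise]).  The proposed
    metric at sigma y is the diagonal matrix of their inverses, so on the metric
    domain the inverse of the metric is the Jacobian
    ([invmx_hopfield_metric]).  There each s_i' is nonzero, and it is nonnegative
    because s_i is increasing; hence the metric is positive definite
    ([spd_hopfield_metric]).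

    What remains is the passage between the equation for the hidden state and the
    equation for x = sigma(xH) ([activation_flowP]), that is, a chain rule in
    each coordinate that can be run in both directions
    ([cvg_quotient_compP]).  It rests on Caratheodory's form of
    differentiability: g z - g y = phi z * (z - y) with phi continuous at y and
    phi y = g'(y).  The difference quotient of g o u is then phi(u r) times that
    of u, and as phi does not vanish one of the two quotients converges if and
    only if the other does, once u is known to be continuous at the time
    considered.  For the direction from x to xH this continuity is recovered from
    that of x: a strictly increasing function reflects convergence
    ([cvg_homo_lt_reflect]). *)

Set Implicit Arguments.
Unset Strict Implicit.

Lemma has_derivative_within_coordP (R : realType) (n : nat) (I : set R)
    (x : R -> 'cV[R]_n) (t : R) (v : 'cV[R]_n) :
  has_derivative_within I x t v <->
  forall i, (r - t)^-1 * (x r i 0 - x t i 0) @[r --> within I t^'] --> v i 0.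
Proof.
rewrite /has_derivative_within; split=> [cvg_q i | cvg_q].
  have := cvg_comp _ _ cvg_q (@coord_continuous _ _ _ i 0 v).
  by apply: cvg_trans; apply: near_eq_cvg; near=> r; rewrite /= !mxE.
apply/cvg_ballP => e e_gt0.
have : \forall r \near within I t^',
    forall i, ball (v i 0) e ((r - t)^-1 * (x r i 0 - x t i 0)).
  by apply: filter_forall => i; move/cvg_ballP: (cvg_q i); exact.
apply: filterS => r near_v; split=> // i j.
by rewrite ord1 !mxE; exact: near_v.
Unshelve. all: by end_near. Qed.

Lemma cvg_quotient_continuous (R : realType) (I : set R) (u : R -> R)
    (t v : R) :
  (r - t)^-1 * (u r - u t) @[r --> within I t^'] --> v ->
  u r @[r --> within I t^'] --> u t.
Proof.
move=> cvg_q.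
have cvg_dt : r - t @[r --> within I t^'] --> 0.
  rewrite -(subrr t); apply: cvgB; last exact: cvg_cst.
  apply: cvg_within_filter; exact: cvg_within.
have cvg_u : u t + (r - t) * ((r - t)^-1 * (u r - u t))
    @[r --> within I t^'] --> u t.
  rewrite -[X in _ --> X]addr0 -(mul0r v).
  by apply: cvgD; [exact: cvg_cst | exact: cvgM].
apply: cvg_trans cvg_u; apply: near_eq_cvg.
rewrite near_withinE near_withinE; near=> r => r_neq_t _.
by rewrite mulVKf ?subr_eq0// addrC subrK.
Unshelve. all: by end_near. Qed.

(** For every e > 0 the value g y lies strictly between g (y - e) and g (y + e),
    so a value g (u r) close enough to g y forces u r to be within e of y. *)
Lemma cvg_homo_lt_reflect (R : realType) (F : set_system R) {FF : Filter F}
    (g u : R -> R) (y : R) :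
  {homo g : a b / a < b} ->
  g (u r) @[r --> F] --> g y -> u r @[r --> F] --> y.
Proof.
move=> g_homo cvg_gu; have g_mono := leW_mono (le_mono g_homo).
apply/cvgrPdist_lt => e e_gt0.
have lt_gy : g (y - e) < g y < g (y + e).
  by rewrite !g_mono ltrBlDr ltrDl e_gt0.
case/andP: lt_gy => lt_gy gt_gy.
have gu_gt : \forall r \near F, g (y - e) < g (u r) by exact: cvgr_gt lt_gy.
have gu_lt : \forall r \near F, g (u r) < g (y + e) by exact: cvgr_lt gt_gy.
apply: filterS2 gu_gt gu_lt => r; rewrite !g_mono => lt_u gt_u.
by rewrite distrC ltr_distl lt_u gt_u.
Qed.

(** The chain rule for w = g o u and its converse.  With Caratheodory's slope
    function phi of g at u t, the quotient of w is phi (u r) times the quotient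
    of u.  The slope phi vanishes nowhere: away from u t because g is injective,
    at u t by the hypothesis on the derivative.  So the factor can also be
    divided out. *)
Lemma cvg_quotient_compP (R : realType) (I : set R) (g u w : R -> R)
    (t v : R) :
  {homo g : a b / a < b} ->
  derivable g (u t) 1 -> derive1 g (u t) != 0 ->
  I t -> (forall r, I r -> w r = g (u r)) ->
  (r - t)^-1 * (u r - u t) @[r --> within I t^'] --> v <->
  (r - t)^-1 * (w r - w t) @[r --> within I t^'] --> derive1 g (u t) * v.
Proof.
move=> g_homo g_der g'_neq0 It wE.
have [phi [phiE phi_cont phi_ut]] :
    exists phi, [/\ forall z, g z - g (u t) = phi z * (z - u t),
        {for u t, continuous phi} & phi (u t) = derive1 g (u t)].
  by apply/is_derive1_caratheodory; rewrite derive1E; exact: derivableP.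
have phi_neq0 z : phi z != 0.
  have [-> | z_neq] := eqVneq z (u t); first by rewrite phi_ut.
  apply: contra_neq z_neq => phi0.
  have /eqP := phiE z; rewrite phi0 mul0r subr_eq0 => /eqP.
  exact: (inc_inj (le_mono g_homo)).
have cvg_phi : u r @[r --> within I t^'] --> u t ->
    phi (u r) @[r --> within I t^'] --> derive1 g (u t).
  by move=> cvg_u; rewrite -phi_ut; exact: cvg_comp _ _ cvg_u phi_cont.
split=> cvg_q.
- have cvg_phiu := cvg_phi (cvg_quotient_continuous cvg_q).
  apply: cvg_trans (cvgM cvg_phiu cvg_q); apply: near_eq_cvg.
  rewrite near_withinE; near=> r => Ir.
  by rewrite /= !wE// phiE mulrCA.
- have cvg_w := cvg_quotient_continuous cvg_q.
  have cvg_u : u r @[r --> within I t^'] --> u t.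
    apply: (cvg_homo_lt_reflect g_homo); rewrite -wE//.
    apply: cvg_trans cvg_w; apply: near_eq_cvg.
    by rewrite near_withinE; near=> r => Ir; rewrite wE.
  rewrite -(mulKf g'_neq0 v).
  apply: cvg_trans (cvgM (cvgV g'_neq0 (cvg_phi cvg_u)) cvg_q).
  apply: near_eq_cvg.
  rewrite near_withinE; near=> r => Ir.
  by rewrite /= !wE// phiE mulrCA mulKf.
Unshelve. all: by end_near. Qed.

(** The difference quotients at y are nonnegative, hence so is their limit. *)
Lemma homo_lt_derive1_ge0 (R : realType) (g : R -> R) (y : R) :
  {homo g : a b / a < b} -> derivable g y 1 -> 0 <= derive1 g y.
Proof.
move=> g_homo g_der; rewrite derive1E.
apply: limr_ge; first exact: g_der.
rewrite near_withinE; near=> h => h_neq0 /=.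
rewrite scaler1 /GRing.scale/=.
have [h_gt0 | h_le0] := ltP 0 h.
  by rewrite mulr_ge0 ?invr_ge0 ?(ltW h_gt0)// subr_ge0 ltW// g_homo// ltrDr.
have h_lt0 : h < 0 by rewrite lt_neqAle h_neq0.
by rewrite mulr_le0 ?invr_le0// subr_le0 ltW// g_homo// gtrDr.
Unshelve. all: by end_near. Qed.

(** The partial difference quotients of sigma are those of the s_i on the
    diagonal and identically zero off it.  The quotients coincide as functions,
    so their limits agree even as values of the total operator [lim]. *)
Lemma jacobian_matrix_componentwise (R : realType) (n : nat)
    (sigma : 'cV[R]_n -> 'cV[R]_n) (s : 'I_n -> R -> R) (p : 'cV[R]_n) :
  (forall y i, sigma y i 0 = s i (y i 0)) ->
  jacobian_matrix sigma p = diag_mx (\row_i derive1 (s i) (p i 0)).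
Proof.
move=> sigmaE; apply/matrixP => i j; rewrite !mxE.
have -> : (fun q => sigma q i 0) = (fun q => s i (q i 0)).
  by apply/funext => q; exact: sigmaE.
rewrite /derive /derive1; have [<- | j_neq_i] := eqVneq i j.
  rewrite mulr1n; set q := (fun h : R => _); set q' := (fun h : R => _).
  suff -> : q = q' by [].
  by apply/funext => h; rewrite /q /q' /= !mxE !eqxx mulr1.
rewrite mulr0n; set q := (fun h : R => _).
have -> : q = fun=> 0.
  apply/funext => h.
  by rewrite /q /= !mxE (negbTE j_neq_i) mulr0 add0r subrr scaler0.
exact: lim_cst.
Qed.

Lemma spd_diag_mx (R : realType) (n : nat) (d : 'rV[R]_n) :
  (forall i, 0 < d 0 i) -> spd_matrix (diag_mx d).
Proof.
move=> d_gt0; split=> [|v v_neq0]; first exact: tr_diag_mx.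
have [i vi_neq0] : exists i, v i 0 != 0.
  by case/cV0Pn: v_neq0 => i; exists i.
rewrite mul_mx_diag mxE (bigD1 i)//= !mxE.
apply: ltr_pwDl.
  by rewrite mulrAC -expr2 mulr_gt0 ?d_gt0// exprn_even_gt0.
apply: sumr_ge0 => j _; rewrite !mxE.
by rewrite mulrAC -expr2 mulr_ge0 ?sqr_ge0// ltW.
Qed.

Lemma pinv_setT_inj (T U : pointedType) (g : T -> U) (y : T) :
  injective g -> pinv setT g (g y) = y.
Proof. by move=> g_inj; apply: pinvKV; [exact: in2W | rewrite in_setT]. Qed.

Lemma activation_inj (R : realType) (n : nat) (sigma : 'cV[R]_n -> 'cV[R]_n)
    (s : 'I_n -> R -> R) : activation sigma s -> injective sigma.
Proof.
case=> [[[_ sigma_inj _] _ _] _ _ _] y z.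
by apply: sigma_inj; rewrite in_setT.
Qed.

Lemma metric_domain_activation (R : realType) (n : nat)
    (sigma : 'cV[R]_n -> 'cV[R]_n) (s : 'I_n -> R -> R) (y : 'cV[R]_n) :
  activation sigma s -> metric_domain s (sigma y) ->
  forall i, derivable (s i) (y i 0) 1 /\ derive1 (s i) (y i 0) != 0.
Proof.
move=> [_ _ sigmaE s_homo] [_ s_der] i.
have := s_der i; rewrite sigmaE /= pinv_setT_inj//.
exact: inc_inj (le_mono (s_homo i)).
Qed.

Lemma hopfield_metricE (R : realType) (n : nat) (sigma : 'cV[R]_n -> 'cV[R]_n)
    (s : 'I_n -> R -> R) (y : 'cV[R]_n) :
  activation sigma s ->
  hopfield_metric s (sigma y) = diag_mx (\row_i (derive1 (s i) (y i 0))^-1).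
Proof.
move=> [_ _ sigmaE s_homo]; apply/matrixP => i j; rewrite !mxE sigmaE.
rewrite pinv_setT_inj; last exact: inc_inj (le_mono (s_homo i)).
by rewrite div1r; case: eqP.
Qed.

Lemma invmx_hopfield_metric (R : realType) (n : nat)
    (sigma : 'cV[R]_n -> 'cV[R]_n) (s : 'I_n -> R -> R) (y : 'cV[R]_n) :
  activation sigma s -> metric_domain s (sigma y) ->
  invmx (hopfield_metric s (sigma y)) = jacobian_matrix sigma y.
Proof.
move=> act dom; have s_der := metric_domain_activation act dom.
rewrite (hopfield_metricE _ act).
have [_ _ sigmaE _] := act; rewrite (jacobian_matrix_componentwise _ sigmaE).
set D := diag_mx _; set J := diag_mx _.
have DJ : D *m J = 1%:M.
  rewrite mulmx_diag -diag_const_mx; congr diag_mx.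
  by apply/rowP => i; rewrite !mxE mulVf//; case: (s_der i).
have [D_unit _] := mulmx1_unit DJ.
by rewrite -[RHS](mulKmx D_unit) DJ mulmx1.
Qed.

Lemma spd_hopfield_metric (R : realType) (n : nat)
    (sigma : 'cV[R]_n -> 'cV[R]_n) (s : 'I_n -> R -> R) (p : 'cV[R]_n) :
  activation sigma s -> metric_domain s p -> spd_matrix (hopfield_metric s p).
Proof.
move=> act dom; have [[[_ _ sigma_surj] _ _] _ _ s_homo] := act.
have [y _ y_p] := sigma_surj _ dom.1; rewrite -y_p in dom *.
have s_der := metric_domain_activation act dom.
rewrite (hopfield_metricE _ act).
apply: spd_diag_mx => i; have [der neq0] := s_der i.
by rewrite mxE invr_gt0 lt_neqAle eq_sym neq0 homo_lt_derive1_ge0.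
Qed.

(** Because the Jacobian is diagonal, the equivalence splits into the scalar
    chain rule [cvg_quotient_compP] in each coordinate. *)
Lemma activation_flowP (R : realType) (n : nat)
    (sigma : 'cV[R]_n -> 'cV[R]_n) (s : 'I_n -> R -> R) (I : set R)
    (xH x : R -> 'cV[R]_n) (t : R) (v : 'cV[R]_n) :
  activation sigma s -> I t -> (forall r, I r -> x r = sigma (xH r)) ->
  metric_domain s (x t) ->
  has_derivative_within I xH t v <->
  has_derivative_within I x t (jacobian_matrix sigma (xH t) *m v).
Proof.
move=> act It xE; rewrite xE// => dom.
have s_der := metric_domain_activation act dom.
have [_ _ sigmaE s_homo] := act.
have coordP i : (r - t)^-1 * (xH r i 0 - xH t i 0) @[r --> within I t^']
      --> v i 0 <->
    (r - t)^-1 * (x r i 0 - x t i 0) @[r --> within I t^']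
      --> (jacobian_matrix sigma (xH t) *m v) i 0.
  rewrite (jacobian_matrix_componentwise _ sigmaE) mul_diag_mx !mxE.
  have [der neq0] := s_der i.
  apply: (cvg_quotient_compP (g := s i) (u := fun r => xH r i 0)
            (w := fun r => x r i 0)) => // r Ir.
  by rewrite xE// sigmaE.
split=> /has_derivative_within_coordP cvg_q;
  by apply/has_derivative_within_coordP => i; apply/coordP.
Qed.

Unset Implicit Arguments.
Set Strict Implicit.

Theorem theorem1 (R : realType) (n : nat) (f : 'cV[R]_n -> R)
    (sigma : 'cV[R]_n -> 'cV[R]_n) (s : 'I_n -> R -> R)
    (f_C1 : continuously_differentiable f)
    (f_ge0 : forall p, closed_cube R n p -> 0 <= f p)
    (sigma_act : activation sigma s)
    (T : \bar R) (T_gt0 : (0 < T)%E) (xH x : R -> 'cV[R]_n) :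
  (* the two forms of the dynamics are equivalent *)
  ((forall t, times T t -> x t = sigma (xH t)) ->
   forall t, times T t -> metric_domain s (x t) ->
     (has_derivative_within (times T) xH t (- gradient f (x t)) <->
      has_derivative_within (times T) x t
        (- (jacobian_matrix sigma (pinv setT sigma (x t))
              *m gradient f (x t))))) /\
  (* the flow is a natural gradient descent *)
  (hopfield_flow f sigma T xH x ->
   [/\ forall t, times T t -> open_cube R n (x t),
       natural_gradient_descent f (metric_domain s) (hopfield_metric s) T x &
       open_cube R n `<=` metric_domain s ->
       natural_gradient_descent f (open_cube R n) (hopfield_metric s) T x]).
Proof.
split=> [xE t It dom | [x0_cube xE xH_flow]].
  rewrite [in pinv _ _ _]xE// (pinv_setT_inj _ (activation_inj sigma_act)).
  by rewrite -mulmxN; exact: (activation_flowP _ sigma_act).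
have x_cube t : times T t -> open_cube R n (x t).
  have [[[sigma_cube _ _] _ _] _ _ _] := sigma_act.
  by move=> It; rewrite xE//; exact: sigma_cube.
have x_flow t : times T t -> metric_domain s (x t) ->
    has_derivative_within (times T) x t
      (- (invmx (hopfield_metric s (x t)) *m gradient f (x t))).
  move=> It dom; rewrite [in invmx _]xE//.
  rewrite (invmx_hopfield_metric sigma_act); last by rewrite -xE.
  by rewrite -mulmxN; exact: (activation_flowP _ sigma_act It xE dom).1
    (xH_flow t It).
split=> //.
  by split=> // p dom; exact: spd_hopfield_metric sigma_act dom.
move=> cube_dom; split=> [p /cube_dom dom | t It /cube_dom]; last exact: x_flow.
exact: spd_hopfield_metric sigma_act dom.
Qed.
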